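(* Let $\Delta:\mathbb{N}^{(2)}\to[k]$ be a surjective $k$-colouring of the edges of the complete graph on $\mathbb{N}$ and suppose $n$ is a natural number such that $k>\binom{n}{2}+1$. Then \[\mathcal{F}_\Delta \cap \left(\binom{n}{2}+1,\ \binom{n+1}{2}+1\right] \neq \emptyset.\]
   Context: Natural numbers are positive integers, $\mathbb{N}=\{1,2,\dots\}$, and $[k]=\{1,\dots,k\}$. For a set $X$, $X^{(2)}$ denotes the family of all $2$-element subsets of $X$. For $X\subset\mathbb{N}$, let $\gamma_\Delta(X)=|\Delta(X^{(2)})|$ be the number of colours appearing on edges inside $X$. Define $\mathcal{F}_\Delta=\{\gamma_\Delta(X): X\subset\mathbb{N},\ X \text{ infinite}\}$. *)

(* Defs.v *)
From mathcomp Require Import all_boot all_order finmap.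
From mathcomp Require Import boolp classical_sets functions cardinality.

Set Implicit Arguments.
Unset Strict Implicit.
Unset Printing Implicit Defensive.

Local Open Scope fset_scope.
Local Open Scope classical_set_scope.

Definition posnat : Type := {m : nat | (0 < m)%N}.

Definition edge : Type := {e : {fset posnat} | #|` e| == 2}.

(* X^(2). *)
Definition pairs (X : set posnat) : set edge := [set e | [set` sval e] `<=` X].

(* The colour set {1, ..., k} is represented by 'I_k, so the set of colours is
   always finite and [fset_set] does not take its default value. *)
Definition gamma (k : nat) (Delta : edge -> 'I_k) (X : set posnat) : nat :=
  #|` fset_set (Delta @` pairs X) |.

Definition gammas (k : nat) (Delta : edge -> 'I_k) : set nat :=
  [set gamma Delta X | X in [set X | infinite_set X]].

(* Main.v *)
Require Import Defs.
From mathcomp Require Import filter zify.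
From mathcomp Require Import all_boot all_order finmap.
From mathcomp Require Import boolp classical_sets functions cardinality.

Set Implicit Arguments.
Unset Strict Implicit.
Unset Printing Implicit Defensive.

(** Some finite set [A] of vertices contains an edge of every colour.  By Ramsey's
theorem together with the pigeonhole principle ([homogeneous_extension]), there
is an infinite [B] whose edges all have the same colour, such that each [a] in [A] is joined to [B] by edges of a single
colour.  For [S] included in [A], let [f S] be the number of colours inside
[S `|` B].  It suffices to find [S] with [f S] in the required interval, so the
problem has become finite.

The function [f] satisfies [f set0 = 1], [f [set v] <= 2] and
[f (R + u + v) + f R <= f (R + u) + f (R + v) + 1]: an edge inside
[R + u + v + B] that avoids neither [u] nor [v] is the edge [uv], which
contributes at most one further colour ([gamma_submodular]).  So the loss
[f S - f (S - v)] of colours when [v] is removed decreases by at most one when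
another vertex is removed first.  Two consequences are that the loss is at most
[#|S|] ([vertex_loss_le]), and that a set of size at least [d] where each vertex
loses at least [d] colours has at least [1 + d + (d - 1) + ... + 1] colours
([large_losses_lower_bound]).

Now take [S] minimal with [f S > 'C(n, 2) + 1].  If [f S] exceeded
['C(n.+1, 2) + 1 = 'C(n, 2) + 1 + n], then the loss at each vertex of [S] would
be at least [n + 1].  Hence [#|S| >= n + 1], and in [S - v] every loss is at
least [n], so [S - v] would have at least ['C(n.+1, 2) + 1 > 'C(n, 2) + 1]
colours, against the minimality of [S] ([finite_interval_hit]). *)

(** * Set functions counting colours *)

Section SetFunctions.

(* The finite-set reading of [set0], [setU], ... is in force in this section only. *)
Import boot.finset.

(** Submodularity up to an error of one; for the number of colours, the error
accounts for the colour of the edge [uv]. *)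
Definition near_submodular (V : finType) (f : {set V} -> nat) : Prop :=
  forall (R : {set V}) u v, f (u |: (v |: R)) + f R <= f (u |: R) + f (v |: R) + 1.

(** Adding one more vertex to [R] raises the loss at [v] by at most one, starting
from a loss of at most one over the empty set. *)
Lemma vertex_loss_le (V : finType) (f : {set V} -> nat) :
    near_submodular f -> (forall v, f [set v] <= f set0 + 1) ->
  forall (R : {set V}) v, f (v |: R) <= f R + #|R| + 1.
Proof.
move=> fC f1 R v; have [m] := ubnP #|R|; elim: m R => // m IH R Rm.
have [->|[u uR]] := set_0Vmem R; first by rewrite setU0 cards0 addn0.
have cR := cardsD1 u R; rewrite uR in cR.
have := IH (R :\ u); have := fC (R :\ u) u v.
rewrite setUCA setD1K // => ? /(_ ltac:(lia)); lia.
Qed.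

Lemma removal_loss_drop (V : finType) (f : {set V} -> nat) :
    near_submodular f ->
  forall (S : {set V}) u v, u \in S -> v \in S -> u != v ->
    f S + f (S :\ v :\ u) <= f (S :\ v) + f (S :\ u) + 1.
Proof.
move=> fC S u v uS vS uv; have := fC (S :\ v :\ u) u v.
have -> : v |: S :\ v :\ u = S :\ u.
  by apply/setP=> w; rewrite !inE; case: (w =P v) => // ->; rewrite eq_sym uv vS.
by rewrite setD1K // setD1K // !inE uv.
Qed.

(** Remove a vertex: this loses [d.+1] colours, and leaves a set to which the
induction hypothesis applies because every other loss drops by at most one. *)
Lemma large_losses_lower_bound (V : finType) (f : {set V} -> nat) :
    near_submodular f -> (forall S, 0 < f S) ->
  forall d (S : {set V}), d <= #|S| ->
    (forall v, v \in S -> f (S :\ v) + d <= f S) -> 'C(d.+1, 2) + 1 <= f S.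
Proof.
move=> fC f_gt0; elim=> [|d IH] S dS loss; first by rewrite bin_small //; have := f_gt0 S.
have [v vS] : exists v, v \in S by apply/card_gt0P; lia.
have cS := cardsD1 v S; rewrite vS in cS.
have lossS := loss v vS.
have: 'C(d.+1, 2) + 1 <= f (S :\ v).
  apply: IH; first lia.
  move=> u /setD1P[uv uS]; have := loss u uS.
  by have := removal_loss_drop fC uS vS uv; lia.
rewrite [X in _ -> X + 1 <= _]binS bin1; lia.
Qed.

Lemma finite_interval_hit (V : finType) (f : {set V} -> nat) n :
    near_submodular f -> (forall S, 0 < f S) -> f set0 = 1 ->
    (forall v, f [set v] <= 2) -> 0 < n -> 'C(n, 2) + 1 < f setT ->
  exists S, 'C(n, 2) + 1 < f S <= 'C(n.+1, 2) + 1.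
Proof.
move=> fC f_gt0 f0 f1 n_gt0 big.
have [S /minsetP[bigS minS] _] :=
  minset_exists (P := fun S : {set V} => 'C(n, 2) + 1 < f S) big.
exists S; rewrite bigS leqNgt; apply/negP => over.
have small v : v \in S -> f (S :\ v) <= 'C(n, 2) + 1.
  move=> vS; rewrite leqNgt; apply/negP => /minS /(_ (subD1set _ _)) Sv.
  by have := vS; rewrite -Sv !inE eqxx.
have binE : 'C(n.+1, 2) = 'C(n, 2) + n by rewrite binS bin1.
have [v vS] : exists v, v \in S.
  by apply/set0Pn/eqP => S0; move: bigS; rewrite S0 f0; lia.
have cS := cardsD1 v S; rewrite vS in cS.
(* The loss at [v] is at least [n + 1] by [over] and [small], and at most [#|S|]. *)
have nS : n <= #|S :\ v|.
  have := vertex_loss_le fC (fun v => ltac:(by rewrite f0)) (S :\ v) v.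
  by rewrite setD1K //; have := small v vS; lia.
have := large_losses_lower_bound fC f_gt0 nS; have := small v vS.
suff: forall u, u \in S :\ v -> f (S :\ v :\ u) + n <= f (S :\ v).
  by move=> H ? /(_ H); lia.
move=> u /setD1P[uv uS]; have := small u uS.
by have := removal_loss_drop fC uS vS uv; lia.
Qed.

End SetFunctions.

Local Open Scope classical_set_scope.

(** * Homogeneous infinite sets *)

Lemma infinite_range_inj (T U : Type) (b : T -> U) :
  infinite_set [set: T] -> injective b -> infinite_set (range b).
Proof.
move=> infT b_inj /(finite_preimage (f := b)) fin; apply: infT.
suff <- : b @^-1` range b = setT by apply: fin => x y _ _; apply: b_inj.
by apply/seteqP; split=> // x _; exists x.
Qed.

(** Otherwise the complements of the finitely many fibres all belong to [F], and so
does their empty intersection. *)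
Lemma ultra_pigeonhole (T : Type) (C : finType) (F : set_system T) (f : T -> C) :
  UltraFilter F -> exists c, F [set x | f x = c].
Proof.
move=> UF; apply: contrapT => noc.
have /filter_forall/filter_ex[x /(_ (f x))] : forall c, F (~` [set x | f x = c]).
  move=> c; have [Fc|//] := in_ultra_setVsetC [set x | f x = c] UF.
  by case: noc; exists c.
exact.
Qed.

(** The one-step form of Ramsey's theorem: for an ultrafilter finer than the
cofinite filter, [c a] is the colour of [a w] for almost all [w], and [c0] is
the value of [c] almost everywhere.  Almost all [w] then work for a given [A]. *)
Lemma eventual_colours (T : choiceType) (C : finType) (col : T -> T -> C) :
    infinite_set [set: T] ->
  exists (c : T -> C) (c0 : C), forall A : {fset T},
    exists w, [/\ w \notin A, c w = c0 & forall a, a \in A -> col a w = c a].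
Proof.
move=> infT.
have [F [UF cofF]] := ultraFilterLemma (frechet_properfilter infT).
have /choice[c Fc] a := ultra_pigeonhole (col a) UF.
have [c0 Fc0] := ultra_pigeonhole c UF.
exists c, c0 => A.
have FA : F (~` [set` A]).
  by apply: cofF; rewrite /frechet_filter /= setCK; exact: finite_fset.
have FF : Filter F by exact: _.
have FcA := @filter_bigI _ _ A (fun a => [set x | col a x = c a]) F FF (fun a _ => Fc a).
have [w [[Aw cw] colw]] := @filter_ex _ F _ _ (filterI (filterI FA Fc0) FcA).
by exists w; split=> //; apply/negP.
Qed.

(** Starting from [A], keep adding a vertex [w] as in [eventual_colours].  Each chosen
vertex has eventual colour [c0], so all its edges to later vertices have colour
[c0], while those from [a] in [A] have colour [c a]. *)
Lemma ramsey_over_finite_set (T : choiceType) (C : finType) (col : T -> T -> C)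
    (A : {fset T}) :
    infinite_set [set: T] ->
  exists (c : T -> C) (c0 : C) (b : nat -> T),
    [/\ injective b, forall i, b i \notin A,
        forall a i, a \in A -> col a (b i) = c a &
        forall i j, i < j -> col (b i) (b j) = c0].
Proof.
move=> infT; have [c [c0 /choice[w wP]]] := eventual_colours col infT.
pose used i := iter i (fun D => w D |` D)%fset A.
have usedA a i : a \in A -> a \in used i.
  by move=> aA; elim: i => //= i IH; rewrite !inE IH orbT.
have used_lt i j : i < j -> w (used i) \in used j.
  elim: j => // j IH; rewrite ltnS leq_eqVlt => /predU1P[->|/IH ij] /=.
    by rewrite !inE eqxx.
  by rewrite !inE ij orbT.
have fresh i j : i < j -> w (used i) != w (used j).
  move=> /used_lt ij; apply: contraTneq ij => ->.
  by have [] := wP (used j).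
exists c, c0, (w \o used); split => [i j ij|i|a i aA|i j ij] /=.
- by case: (ltngtP i j) => // /fresh; rewrite /= in ij; rewrite ij eqxx.
- by have [/negP nw _ _] := wP (used i); apply/negP => /usedA.
- by have [_ _ ->] := wP (used i); rewrite ?usedA.
- by have [_ _ ->] := wP (used j); [have [_ ->] := wP (used i)|exact: used_lt].
Qed.

(** * Colours seen by a set of vertices *)

Lemma edgeP (e : edge) : exists u v, u != v /\ sval e = [fset u; v]%fset.
Proof.
case: e => e /= e2; have /fset0Pn[u ue] : e != fset0.
  by rewrite -cardfs_eq0 (eqP e2).
have /cardfs1P[v ev] : #|` e `\ u|%fset == 1.
  by have := cardfsD1 u e; rewrite ue (eqP e2) add1n => -[<-].
exists u, v; split; last by rewrite -(fsetD1K ue) ev.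
have : v \in (e `\ u)%fset by rewrite ev inE.
by rewrite !inE eq_sym => /andP[].
Qed.

(** Turns the colouring of edges into a function of two vertices, to which
[ramsey_over_finite_set] applies. *)
Lemma colour_of_pair (k : nat) (Delta : edge -> 'I_k) : 0 < k ->
  exists col : posnat -> posnat -> 'I_k,
    forall e u v, sval e = [fset u; v]%fset -> Delta e = col u v.
Proof.
move=> k_gt0.
exists (fun u v => oapp Delta (Ordinal k_gt0) (insub [fset u; v]%fset)) => e u v <-.
by rewrite (valK e).
Qed.

Lemma coloursP (k : nat) (Delta : edge -> 'I_k) (X : set posnat) c :
  reflect (exists2 e, pairs X e & Delta e = c) (c \in fset_set (Delta @` pairs X)).
Proof.
rewrite in_fset_set; last exact: (@finite_finset 'I_k).
by apply: (iffP idP); rewrite inE.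
Qed.

Lemma mem_colours (k : nat) (Delta : edge -> 'I_k) (X : set posnat) e :
  pairs X e -> Delta e \in fset_set (Delta @` pairs X).
Proof. by move=> Xe; apply/coloursP; exists e. Qed.

Lemma gamma_le (k : nat) (Delta : edge -> 'I_k) (X : set posnat) (D : {fset 'I_k}) :
  (forall e, pairs X e -> Delta e \in D) -> gamma Delta X <= #|` D|.
Proof.
by move=> H; apply/fsubset_leq_card/fsubsetP => c /coloursP[e /H ? <-].
Qed.

Lemma gamma_gt0 (k : nat) (Delta : edge -> 'I_k) (X : set posnat) e :
  pairs X e -> 0 < gamma Delta X.
Proof.
move=> /(mem_colours Delta) Xe; rewrite cardfs_gt0.
by apply: contraTneq Xe => ->; rewrite inE.
Qed.

Lemma sub_pairs (X Y : set posnat) : X `<=` Y -> pairs X `<=` pairs Y.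
Proof. by move=> XY e /subset_trans; exact. Qed.

(** Inside [X + u + v], an edge avoiding [u] lies in [X + v], an edge avoiding [v]
lies in [X + u], and the only edge left is [uv].  The colours inside [X] occur in
both [X + u] and [X + v]. *)
Lemma gamma_submodular (k : nat) (Delta : edge -> 'I_k) (X : set posnat) u v :
    0 < k ->
  gamma Delta (u |` (v |` X)) + gamma Delta X <=
  gamma Delta (u |` X) + gamma Delta (v |` X) + 1.
Proof.
move=> /(colour_of_pair Delta)[col colP].
pose Cu := fset_set (Delta @` pairs (u |` X)).
pose Cv := fset_set (Delta @` pairs (v |` X)).
have outer : gamma Delta (u |` (v |` X)) <= #|` Cu `|` Cv|%fset + 1.
  apply: (@leq_trans #|` col u v |` (Cu `|` Cv)|%fset).
    apply: gamma_le => e eX; rewrite !inE.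
    have [uv|uv] := eqVneq u v.
      by rewrite [_ \in Cu]mem_colours ?orbT // => x /eX; rewrite uv => -[->|//]; left.
    have [ue|ue] := boolP (u \in sval e); last first.
      rewrite [_ \in Cv]mem_colours ?orbT // => x /= xe.
      by have [xu|//] := eX _ xe; rewrite -xu xe in ue.
    have [ve|ve] := boolP (v \in sval e); last first.
      rewrite [_ \in Cu]mem_colours ?orbT // => x /= xe.
      have [->|[xv|xX]] := eX _ xe; [by left| |by right].
      by rewrite -xv xe in ve.
    rewrite (colP e u v) ?eqxx //; apply/esym/eqP.
    rewrite eqEfcard (eqP (svalP e)) cardfs2 uv leqnn andbT.
    by apply/fsubsetP => x /fset2P[]->.
  by rewrite cardfsU1; lia.
have inner : gamma Delta X <= #|` Cu `&` Cv|%fset.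
  apply: gamma_le => e eX; rewrite !inE.
  by rewrite !mem_colours //; apply: sub_pairs eX => x; right.
have := cardfsUI (Cu) (Cv).
rewrite /gamma -/Cu -/Cv in outer inner *; lia.
Qed.

Lemma infinite_posnat : infinite_set [set: posnat].
Proof.
pose s i : posnat := exist _ i.+1 isT.
apply: (sub_infinite_set (A := range s)) => //.
by apply: infinite_range_inj; [exact: infinite_nat|move=> i j []].
Qed.

Lemma finite_set_seeing_all_colours (k : nat) (Delta : edge -> 'I_k) :
    (forall c : 'I_k, exists e : edge, Delta e = c) ->
  exists A : {fset posnat}, forall X, [set` A] `<=` X -> k <= gamma Delta X.
Proof.
move=> /choice[e eP].
exists (\bigcup_(c <- enum 'I_k) sval (e c))%fset => X AX.
rewrite -[X in X <= _]card_ord -card_finset; apply: fsubset_leq_card.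
apply/fsubsetP => c _; apply/coloursP; exists (e c) => // x /= xe; apply: AX => /=.
by apply/bigfcupP; exists c; rewrite ?mem_enum.
Qed.

(** The case of Ramsey's theorem that reduces the problem to subsets of [A]: besides
the single colour of [B], the vertex [a] brings only its common colour to [B]. *)
Lemma homogeneous_extension (k : nat) (Delta : edge -> 'I_k) (A : {fset posnat}) :
    0 < k ->
  exists B : set posnat,
    [/\ infinite_set B, gamma Delta B = 1 &
        forall a, a \in A -> gamma Delta (a |` B) <= 2].
Proof.
move=> /(colour_of_pair Delta)[col colP].
have [c [c0 [b [b_inj bA colA colB]]]] :=
  ramsey_over_finite_set col A infinite_posnat.
have colBB e : pairs (range b) e -> Delta e = c0.
  move=> eB; have [u [v [uv euv]]] := edgeP e.
  have [i _ bi] : range b u by apply: eB; rewrite /= euv !inE eqxx.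
  have [j _ bj] : range b v by apply: eB; rewrite /= euv !inE eqxx orbT.
  case: (ltngtP i j) => ij; last by rewrite -bi -bj ij eqxx in uv.
    by rewrite (colP e u v) // -bi -bj colB.
  by rewrite (colP e v u) 1?fsetUC // -bi -bj colB.
exists (range b); split.
- by apply: infinite_range_inj => //; exact: infinite_nat.
- apply/eqP; rewrite eqn_leq; apply/andP; split.
    apply: (@leq_trans #|` [fset c0]%fset|); last by rewrite cardfs1.
    by apply: gamma_le => e /colBB ->; rewrite inE.
  have e01 : #|` [fset b 0; b 1]%fset| == 2.
    by rewrite cardfs2 (inj_eq b_inj).
  apply: (@gamma_gt0 _ _ _ (exist _ [fset b 0; b 1]%fset e01)) => x /=.
  by case/fset2P => ->; [exists 0|exists 1].
- move=> a aA; apply: (@leq_trans #|` [fset c0; c a]%fset|); last first.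
    by rewrite cardfs2; case: eqP.
  apply: gamma_le => e eaB; rewrite !inE.
  have [ae|ae] := boolP (a \in sval e); last first.
    rewrite (colBB e) ?eqxx // => x /= xe.
    by have [xa|//] := eaB _ xe; rewrite -xa xe in ae.
  suff [i ei] : exists i, sval e = [fset a; b i]%fset.
    by rewrite (colP e a (b i)) // colA // eqxx orbT.
  have [u [v [uv euv]]] := edgeP e.
  have [u_in v_in] : (a |` range b) u /\ (a |` range b) v.
    by split; apply: eaB; rewrite /= euv !inE eqxx ?orbT.
  move: ae; rewrite euv => /fset2P[] aE; subst a.
    by case: v_in => [vu|[i _ <-]]; [rewrite vu eqxx in uv|exists i].
  case: u_in => [vu|[i _ <-]]; first by rewrite vu eqxx in uv.
  by exists i; rewrite fsetUC.
Qed.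

Theorem mainTheorem3 (k n : nat) (Delta : edge -> 'I_k)
    (Delta_surj : forall c : 'I_k, exists e : edge, Delta e = c)
    (n_gt0 : (0 < n)%N) (k_gt : ('C(n, 2) + 1 < k)%N) :
  gammas Delta `&` [set m : nat | ('C(n, 2) + 1 < m <= 'C(n.+1, 2) + 1)%N] !=set0.
Proof.
have k_gt0 : 0 < k by lia.
have [A allA] := finite_set_seeing_all_colours Delta_surj.
have [B [infB gB gaB]] := homogeneous_extension Delta A k_gt0.
pose ext (S : {set A}) : set posnat := (val @` [set` S]) `|` B.
have extU v S : ext (v |: S)%SET = val v |` ext S.
  rewrite /ext setUA; congr (_ `|` _); apply/seteqP; split=> [_ [a /= + <-]|x /=].
    by rewrite !inE => /orP[/eqP->|aS]; [left|right; exists a].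
  by case=> [->|[a /= aS <-]]; [exists v|exists a] => //=; rewrite !inE ?eqxx ?aS ?orbT.
have ext0 : ext finset.set0 = B.
  apply/seteqP; split=> [x [[a /=]|//]|x]; first by rewrite inE.
  by right.
have ext1 v : ext (finset.set1 v) = val v |` B.
  by rewrite -ext0 -extU finset.setU0.
have [||||||S Sn] := @finite_interval_hit _ (fun S => gamma Delta (ext S)) n.
- by move=> R u v; rewrite !extU; apply: gamma_submodular.
- move=> S; apply: leq_trans (_ : gamma Delta B <= _); first by rewrite gB.
  by apply: gamma_le => e eB; apply: mem_colours; apply: sub_pairs eB => x; right.
- by rewrite ext0.
- by move=> v; rewrite ext1; apply: gaB; exact: fsvalP.
- exact: n_gt0.
- apply: leq_trans k_gt _; apply: allA => x /= xA; left.
  by exists [` xA]%fset => //=; rewrite inE.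
exists (gamma Delta (ext S)); split=> //; exists (ext S) => //=.
by apply: sub_infinite_set infB => x; right.
Qed.
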